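(* Fix an integer $m\ge 1$ and $n\ge 1$. The map $\mathfrak{m}$, sending a colored permutation $u\in C_m\wr\mathfrak{S}_n$ to the sequence \[\mathfrak{m}(u)=(\mathrm{C}^{(m)}(u[1]),\mathrm{C}^{(m)}(u[2]),\ldots,\mathrm{C}^{(m)}(u[n])),\] is a bijection from $C_m\wr\mathfrak{S}_n$ to the set of all saturated chains $\emptyset=\alpha^0\prec\alpha^1\prec\cdots\prec\alpha^n=\alpha$ in $\mathrm{Comp}^{(m)}$, where $\alpha$ ranges over all $m$-colored compositions of $n$ (the sequence $\mathfrak{m}(u)$ being identified with the chain $\emptyset\prec \mathrm{C}^{(m)}(u[1])\prec\cdots\prec\mathrm{C}^{(m)}(u[n])$).
   Context: Let $\omega$ be a primitive $m$-th root of unity and $C_m=\{1,\omega,\ldots,\omega^{m-1}\}$. An $m$-colored composition of $n$ is a tuple $\alpha=(\varepsilon_1\alpha_1,\ldots,\varepsilon_k\alpha_k)$ of positive integers $\alpha_s$ with colors $\varepsilon_s\in C_m$ and $\alpha_1+\cdots+\alpha_k=n$; $\emptyset$ is the unique one of $0$. Let $\mathrm{Comp}^{(m)}$ be the set of all $m$-colored compositions of all $n\ge0$, partially ordered as the poset generated by the following covering relations: $\beta$ covers $\alpha=(\varepsilon_1\alpha_1,\ldots,\varepsilon_k\alpha_k)$ (written $\alpha\prec\beta$) iff for some $j$, $\beta$ equals one of (1) $(\ldots,\varepsilon_{j-1}\alpha_{j-1},\varepsilon_j(\alpha_j+1),\varepsilon_{j+1}\alpha_{j+1},\ldots)$; (2)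 $(\ldots,\varepsilon_{j-1}\alpha_{j-1},\varepsilon_j(h+1),\varepsilon_j(\alpha_j-h),\varepsilon_{j+1}\alpha_{j+1},\ldots)$ for some $0\le h\le\alpha_j-1$; (3) $(\ldots,\varepsilon_{j-1}\alpha_{j-1},\varepsilon_j h,\varepsilon'1,\varepsilon_j(\alpha_j-h),\varepsilon_{j+1}\alpha_{j+1},\ldots)$ with $\varepsilon'\ne\varepsilon_j$, $0\le h\le\alpha_j-1$, where parts of size $0$ are deleted (for $\alpha=\emptyset$, the covers are $(\varepsilon 1)$, $\varepsilon\in C_m$). A saturated chain from $\emptyset$ to $\alpha$ with $|\alpha|=n$ is a sequence $\emptyset=\alpha^0\prec\alpha^1\prec\cdots\prec\alpha^n=\alpha$. An $m$-colored permutation $u=u_1\cdots u_n\in C_m\wr\mathfrak{S}_n$ is a word in letters $\varepsilon i$ ($\varepsilon\in C_m$, $i\in[n]$) such that $|u_1|\cdots|u_n|$ is a permutation of $[n]$; the color of $u_i$ is $u_i/|u_i|$. The colored descent composition $\mathrm{C}^{(m)}(u)$ is obtained as follows: write $u=v_1\cdots v_k$ with each $v_i$ a maximal nonempty factor whose letters all have the same color $\varepsilon'_i$ (so $\varepsilon'_i\neq\varepsilon'_{i+1}$); replace each $v_i$ by the list of lengths of the maximal increasing runs of $|v_i|$ (left to right), each colored $\varepsilon'_i$; concatenating gives $\mathrm{C}^{(m)}(u)$. Equivalently, it lists the lengths and colors of the maximal runs of consecutive letters of constant color whose absolute values increase. For $u\in C_m\wr\mathfrak{S}_n$ and $i\le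 n$, $u[i]$ denotes the subword of $u$ consisting of letters with absolute value in $[i]$.
   Formalization: In covering relation (3) the range 0 ≤ h ≤ α_j − 1 is corrected to 0 ≤ h ≤ α_j, adding the covers that append ε'1 (ε' ≠ ε_k) at the right end; as printed the claim fails for all m, n ≥ 2, e.g. for u = 1, ω2. *)

(* Defs.v *)
From HB Require Import structures.
From mathcomp Require Import all_boot all_order all_algebra all_field.
From mathcomp Require Import classical_sets functions.

Set Implicit Arguments.
Unset Strict Implicit.
Unset Printing Implicit Defensive.

Import GRing.Theory.

Definition Cm (m : nat) (w : algC) : Type :=
  {z : algC | z \in [seq (w ^+ i)%R | i <- iota 0 m]}.

HB.instance Definition _ m w := Equality.on (Cm m w).

Section Colored.

Variable C : eqType.

(* The pair (e, a) stands for the part "e a"; parts are positive. *)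
Record ccomp : Type := CComp {
  parts :> seq (C * nat);
  parts_gt0 : all (fun p => 0 < p.2) parts
}.

HB.instance Definition _ := [isSub for parts].
HB.instance Definition _ := [Equality of ccomp by <:].

Definition cempty : ccomp := @CComp [::] isT.

Definition csize (al : ccomp) : nat := \sum_(p <- parts al) p.2.

Definition del0 (s : seq (C * nat)) : seq (C * nat) :=
  [seq p <- s | 0 < p.2].

(* In cover_insert the printed bound h <= a - 1 is corrected to h <= a:
   h = a on the last part places the new part e' 1 at the right end, a cover which no other
   clause produces, and which is needed already for (e 1) < (e 1, e' 1).  On a
   part that is not the last one, h = a gives nothing new. *)
Inductive cover (al be : ccomp) : Prop :=
| cover_empty e of
    parts al = [::] & parts be = [:: (e, 1)]
| cover_incr p e a q of
    parts al = p ++ (e, a) :: q & parts be = p ++ (e, a.+1) :: q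
| cover_split p e a q h of
    parts al = p ++ (e, a) :: q & h < a
  & parts be = p ++ [:: (e, h.+1); (e, a - h)] ++ q
| cover_insert p e a q h e' of
    parts al = p ++ (e, a) :: q & e' != e & h <= a
  & parts be = del0 (p ++ [:: (e, h); (e', 1); (e, a - h)] ++ q).

(* s lists alpha^0, alpha^1, ..., alpha^n, both ends included. *)
Definition saturated_chain (n : nat) (al : ccomp) (s : seq ccomp) : Prop :=
  [/\ size s = n.+1,
      nth cempty s 0 = cempty,
      forall i, i < n -> cover (nth cempty s i) (nth cempty s i.+1)
    & nth cempty s n = al].

Definition saturated_chains (n : nat) : set (seq ccomp) :=
  fun s => exists2 al, csize al = n & saturated_chain n al s.

(* The pair (e, i) stands for the letter "e i", of color e and absolute
   value i. *)
Definition word : Type := seq (C * nat).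

Definition colored_perms (n : nat) : set word :=
  fun u => perm_eq [seq x.2 | x <- u] (iota 1 n).

Definition subword (u : word) (i : nat) : word :=
  [seq x <- u | x.2 \in iota 1 i].

Definition incr_head (s : seq (C * nat)) : seq (C * nat) :=
  if s is (e, a) :: q then (e, a.+1) :: q else [::].

(* Colors and lengths of the maximal runs of consecutive letters of constant
   color and increasing absolute value. *)
Fixpoint cruns (u : word) : seq (C * nat) :=
  if u is x :: v then
    if v is y :: _ then
      if (x.1 == y.1) && (x.2 < y.2) then incr_head (cruns v)
      else (x.1, 1) :: cruns v
    else [:: (x.1, 1)]
  else [::].

Lemma cruns_gt0 (u : word) : all (fun p => 0 < p.2) (cruns u).
Proof.
elim: u => [|x [|y v] IH] //.
rewrite [cruns _]/=; case: ifP => _; last by rewrite /= -/(cruns (y :: v)) IH.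
by move: IH; rewrite -/(cruns (y :: v)); case: (cruns _) => [|[e a] q] //= /andP[].
Qed.

Definition cdes (u : word) : ccomp := CComp (cruns_gt0 u).

Definition mmap (n : nat) (u : word) : seq ccomp :=
  [seq cdes (subword u i) | i <- iota 1 n].

End Colored.

Arguments cempty {C}.

(* Main.v *)
Require Import Defs.
From HB Require Import structures.
From mathcomp Require Import all_boot all_order all_algebra all_field.
From mathcomp Require Import classical_sets functions.

(** Record a colored word by listing, for each letter, its color together with
    the bit telling whether the next letter belongs to the same run; colored
    compositions are the same data.  Inserting a letter of color [e] that
    exceeds all the others adds the entry [(e, false)] and replaces the bit of
    the preceding letter by the truth value of "it has color [e]".  This
    operation on codes is injective in the position and the color, and its
    values at the code of [al] are exactly the codes of the covers of [al].
    Since a colored permutation of [n + 1] is a colored permutation of [n] with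
    such a letter inserted, the theorem follows by induction on [n]. *)

Set Implicit Arguments.
Unset Strict Implicit.
Unset Printing Implicit Defensive.

Section RunCodes.

Variable C : eqType.
Implicit Types (e f : C) (s t : seq (C * bool)) (p q r : seq (C * nat)).
Implicit Types (u v : word C) (al be : ccomp C).

(** * Codes of compositions and words, and insertion into them *)

Definition part_code (x : C * nat) : seq (C * bool) :=
  if x.2 is b.+1 then rcons (nseq b (x.1, true)) (x.1, false) else [::].

Definition comp_code r : seq (C * bool) := flatten [seq part_code x | x <- r].

(** The recursion of [cruns], with the stored bit in place of the comparison of adjacent letters. *)
Fixpoint comp_of_code s : seq (C * nat) :=
  if s is x :: s' then
    if x.2 then incr_head (comp_of_code s') else (x.1, 1) :: comp_of_code s'
  else [::].

Fixpoint word_code u : seq (C * bool) :=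
  if u is x :: v then
    (x.1, if v is y :: _ then (x.1 == y.1) && (x.2 < y.2) else false)
      :: word_code v
  else [::].

(** [k] counts the entries left of the new one. The inner test on [k'] detects the entry just before
    the insertion point, whose bit is overwritten. Meaningful for [k <= size s] only. *)
Fixpoint code_insert e k s : seq (C * bool) :=
  match k, s with
  | k'.+1, x :: s' =>
      if k' is 0 then (x.1, x.1 == e) :: (e, false) :: s'
      else x :: code_insert e k' s'
  | _, _ => (e, false) :: s
  end.

Definition word_insert (x : C * nat) k u : word C := take k u ++ x :: drop k u.

Lemma comp_code_cat p q : comp_code (p ++ q) = comp_code p ++ comp_code q.
Proof. by rewrite /comp_code map_cat flatten_cat. Qed.

Lemma comp_code_cons x q : comp_code (x :: q) = part_code x ++ comp_code q.
Proof. by []. Qed.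

(** Parts of size 0 have empty code, so codes absorb the deletion convention of [cover_insert]. *)
Lemma comp_code_del0 r : comp_code (del0 r) = comp_code r.
Proof.
by elim: r => [|[e [|a]] r IH] //=; rewrite ?comp_code_cons ?IH // [in LHS]IH.
Qed.

Lemma size_part_code x : size (part_code x) = x.2.
Proof. by case: x => e [|a] //=; rewrite size_rcons size_nseq. Qed.

Lemma size_comp_code r : size (comp_code r) = \sum_(x <- r) x.2.
Proof.
elim: r => [|x r IH]; first by rewrite big_nil.
by rewrite comp_code_cons size_cat size_part_code IH big_cons.
Qed.

Lemma comp_codeK r : all (fun x => 0 < x.2) r -> comp_of_code (comp_code r) = r.
Proof.
elim: r => [|[e [|a]] r IH] //= r_gt0; rewrite comp_code_cons /= cat_rcons.
by elim: a => [|a IHa] /=; rewrite ?IH // IHa.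
Qed.

Lemma comp_code_inj al be : comp_code al = comp_code be -> al = be.
Proof.
move=> eq_code; apply: val_inj => /=.
by rewrite -[LHS]comp_codeK ?parts_gt0 // eq_code comp_codeK ?parts_gt0.
Qed.

(** Ensures that [incr_head] always meets an actual part, of the color of the first letter. *)
Lemma cruns_cons x v : exists a q, cruns (x :: v) = (x.1, a.+1) :: q.
Proof.
elim: v x => [|y v IH] x; first by exists 0, [::].
have [a [q E]] := IH y; rewrite [cruns _]/= -/(cruns (y :: v)) E.
case: ifP => [/andP[/eqP -> _]|_]; first by exists a.+1, q.
by exists 0, ((y.1, a.+1) :: q).
Qed.

Lemma comp_code_cruns u : comp_code (cruns u) = word_code u.
Proof.
elim: u => [|x [|y v] IH] //; rewrite [cruns _]/= -/(cruns (y :: v)).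
have [a [q E]] := cruns_cons y v.
rewrite [word_code _]/= -/(word_code (y :: v)) -IH E.
by case: ifP => [/andP[/eqP <- _]|_].
Qed.

Lemma size_word_code u : size (word_code u) = size u.
Proof. by elim: u => //= x u ->. Qed.

Lemma csize_cdes u : csize (cdes u) = size u.
Proof. by rewrite /csize -size_comp_code comp_code_cruns size_word_code. Qed.

(** The new letter is larger than its successor, so it ends its run; it is larger than its
    predecessor, so it continues that run exactly when the colors agree. *)
Lemma word_code_insert e b k v : all (fun x => x.2 < b) v -> k <= size v ->
  word_code (word_insert (e, b) k v) = code_insert e k (word_code v).
Proof.
rewrite /word_insert; elim: v k => [|x v IH] [|k] //.
  by move=> /= /andP[lt_xb _] _; rewrite [b < _]ltnNge ltnW // andbF.
move=> /= /andP[lt_xb lt_vb] le_k.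
case: k le_k => [|k] le_k.
  rewrite take0 drop0 /= lt_xb andbT; congr [:: _, _ & _].
  by case: v lt_vb {IH le_k} => //= y v /andP[lt_yb _]; rewrite [b < _]ltnNge ltnW ?andbF.
by rewrite IH //; case: v lt_vb le_k {IH}.
Qed.

(** Equality would pass to the tails down to the entry [x] before the insertion point; there [x]
    must be [(e', false)], yet its rewritten bit [x.1 == e'] must be false. *)
Lemma code_insert_neq0 e e' k s : k < size s ->
  (e, false) :: s <> code_insert e' k.+1 s.
Proof.
elim: s k => [|x s IH] [|k] //= le_k.
  by case=> _ neq_x def_x; rewrite def_x /= eqxx in neq_x.
by case=> <-; apply: IH.
Qed.

(** After stripping common entries, either the two positions agree or [code_insert_neq0] gives a
    contradiction. *)
Lemma code_insert_inj e e' k k' s : k <= size s -> k' <= size s ->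
  code_insert e k s = code_insert e' k' s -> e = e' /\ k = k'.
Proof.
elim: s k k' => [|x s IH] [|k] [|k'] //; try by move=> _ _ [].
- by move=> _ le_k' /code_insert_neq0; case.
- by move=> le_k _ /esym/code_insert_neq0; case.
case: k k' => [|k] [|k'] le_k le_k' //=.
- by case.
- by case=> _ /code_insert_neq0; case.
- by case=> _ /esym/code_insert_neq0; case.
by case=> /(IH k.+1 k'.+1 le_k le_k')[-> [->]].
Qed.

(** * Covers of a composition as insertions into its code *)

Lemma code_insert_cat e s x t :
  code_insert e (size s).+1 (s ++ x :: t)
  = s ++ (x.1, x.1 == e) :: (e, false) :: t.
Proof. by elim: s => //= y s ->. Qed.

Lemma part_code_gt0 e h : 0 < h ->
  part_code (e, h) = nseq h.-1 (e, true) ++ [:: (e, false)].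
Proof. by case: h => // h _; rewrite cats1. Qed.

(** Isolates the [h]-th entry of the run, the one whose bit an insertion after it rewrites. *)
Lemma part_code_cut e a h : 0 < h <= a ->
  part_code (e, a) = nseq h.-1 (e, true) ++ (e, h < a) :: part_code (e, a - h).
Proof.
case: h => // h /= /subnKC; move: (a - h.+1) => b <-{a}.
rewrite addSn; case: b => [|b].
  by rewrite addn0 ltnn cats1.
by rewrite ltnS -addSnnS leq_addr addSnnS /part_code /= -rcons_cons -rcons_cat nseqD.
Qed.

(** An equal color extends the first [h] letters by one, another color cuts after them. For [h = a]
    the last part has size 0 and empty code, so lengthening a part is included. *)
Lemma code_insert_part e' p e a q h : 0 < h <= a ->
  code_insert e' (size (comp_code p) + h) (comp_code (p ++ (e, a) :: q))
  = comp_code (p ++ (if e == e' then [:: (e, h.+1); (e, a - h)]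
                     else [:: (e, h); (e', 1); (e, a - h)]) ++ q).
Proof.
move=> h_a; have [h_gt0 _] := andP h_a.
rewrite !comp_code_cat comp_code_cons (part_code_cut e h_a).
rewrite -catA catA /=.
have -> : size (comp_code p) + h
          = (size (comp_code p ++ nseq h.-1 (e, true))).+1.
  by rewrite size_cat size_nseq -addnS prednK.
rewrite code_insert_cat /= -catA; congr (_ ++ _).
case: eqP => [<-|_]; rewrite !comp_code_cons.
  rewrite (@part_code_gt0 e h.+1) //= -{3}(prednK h_gt0) -addn1 nseqD.
  by rewrite -!catA.
by rewrite (part_code_gt0 e h_gt0) -!catA.
Qed.

(* Inserting right after [p] would lengthen the last part of [p] if that part
   has color [e]; one inserts before its last letter instead, going further
   back when its size is 1. *)
Lemma code_insert_new e p t : all (fun x => 0 < x.2) p ->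
  exists2 k, k <= size (comp_code p)
    & code_insert e k (comp_code p ++ t) = comp_code p ++ (e, false) :: t.
Proof.
elim/last_ind: p t => [|p [f a] IH] t; first by exists 0.
rewrite all_rcons => /andP[/= a_gt0 p_gt0].
have -> : comp_code (rcons p (f, a))
          = (comp_code p ++ nseq a.-1 (f, true)) ++ [:: (f, false)].
  by rewrite -cats1 comp_code_cat comp_code_cons cats0 part_code_gt0 // catA.
rewrite !size_cat /= addn1 -!(catA _ [:: _]) /=.
have [->{f}|neq_fe] := eqVneq f e; last first.
  exists (size (comp_code p ++ nseq a.-1 (f, true))).+1; first by rewrite size_cat.
  by rewrite code_insert_cat /= (negPf neq_fe).
case: a a_gt0 => // -[|a] _ /=.
  have [k le_k E] := IH ((e, false) :: t) p_gt0.
  by exists k; rewrite ?cats0 // addn0 ltnW.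
have -> : comp_code p ++ (e, true) :: nseq a (e, true)
          = (comp_code p ++ nseq a (e, true)) ++ [:: (e, true)].
  by rewrite -[_ :: nseq _ _]/(nseq a.+1 _) -addn1 nseqD catA.
(* The preceding bit is already true and stays so; the new entry equals the old last entry
   [(e, false)], so their order is invisible. *)
exists (size (comp_code p ++ nseq a (e, true))).+1.
  by rewrite size_cat size_nseq addnS leqW.
by rewrite -!(catA _ [:: _]) code_insert_cat /= eqxx.
Qed.

(** A boundary between two parts is attributed to the part on its left, as [h = a]. *)
Lemma comp_code_position r k : k < size (comp_code r) ->
  exists p e a q h,
    [/\ r = p ++ (e, a) :: q, 0 < h <= a & k.+1 = size (comp_code p) + h].
Proof.
elim: r k => [|[e a] r IH] k //.
rewrite comp_code_cons size_cat size_part_code /= => lt_k.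
have [lt_ka|le_ak] := ltnP k a.
  by exists [::], e, a, r, k.+1.
have [|p [f [b [q [h [-> h_b E]]]]]] := IH (k - a).
  by rewrite ltn_subLR.
exists ((e, a) :: p), f, b, q, h; split=> //.
by rewrite comp_code_cons size_cat size_part_code /= -addnA -E addnS subnKC.
Qed.

Lemma cover_code_insert al be : Defs.cover al be ->
  exists e k, k <= size (comp_code al)
    /\ comp_code be = code_insert e k (comp_code al).
Proof.
have gt0_cat p e a q : parts al = p ++ (e, a) :: q ->
    all (fun x => 0 < x.2) p /\ 0 < a.
  by move=> E; have := parts_gt0 al; rewrite E all_cat /= => /and3P[].
have le_pos p e a q h : h <= a ->
    size (comp_code p) + h <= size (comp_code (p ++ (e, a) :: q)).
  move=> le_ha; rewrite comp_code_cat comp_code_cons !size_cat size_part_code.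
  by rewrite leq_add2l (leq_trans le_ha) ?leq_addr.
(* This serves the splitting and inserting clauses with [h = 0], where a part of size 1 appears in
   front of the chosen part. *)
have new p e r : parts al = p ++ r -> all (fun x => 0 < x.2) p ->
    parts be = p ++ (e, 1) :: r -> exists e k, k <= size (comp_code al)
    /\ comp_code be = code_insert e k (comp_code al).
  move=> -> p_gt0 ->; have [k le_k E] := code_insert_new e (comp_code r) p_gt0.
  exists e, k; rewrite !comp_code_cat comp_code_cons E size_cat.
  by rewrite (leq_trans le_k) ?leq_addr.
case=> [e Ea Eb|p e a q Ea Eb|p e a q h Ea lt_ha Eb|p e a q h e' Ea neq_e le_ha Eb].
- by exists e, 0; rewrite Ea Eb.
- have [_ a_gt0] := gt0_cat _ _ _ _ Ea.
  exists e, (size (comp_code p) + a); rewrite Ea Eb le_pos // code_insert_part ?a_gt0 //=.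
  by rewrite eqxx subnn -[in RHS]comp_code_del0 -[in LHS]comp_code_del0 /del0 !filter_cat.
- have [p_gt0 a_gt0] := gt0_cat _ _ _ _ Ea.
  case: h => [|h] in lt_ha Eb; first by rewrite subn0 in Eb; apply: new Ea p_gt0 Eb.
  exists e, (size (comp_code p) + h.+1).
  by rewrite Ea Eb le_pos ?code_insert_part ?eqxx //; apply: ltnW.
have [p_gt0 a_gt0] := gt0_cat _ _ _ _ Ea.
case: (posnP h) le_ha Eb => [->|h_gt0] le_ha Eb.
  apply: (new p e' _ Ea p_gt0).
  have := parts_gt0 al; rewrite Eb Ea subn0 all_cat /= => /and3P[_ _ q_gt0].
  by rewrite /del0 filter_cat /= a_gt0; congr (_ ++ [:: _, _ & _]); apply/all_filterP.
exists e', (size (comp_code p) + h).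
rewrite Ea Eb le_pos // comp_code_del0 code_insert_part ?h_gt0 //.
by rewrite eq_sym (negPf neq_e).
Qed.

Lemma code_insert_cover al be e k : k <= size (comp_code al) ->
  comp_code be = code_insert e k (comp_code al) -> Defs.cover al be.
Proof.
have be_code r : comp_code be = comp_code r -> parts be = del0 r.
  rewrite -(comp_code_del0 r) => E.
  by rewrite -(comp_codeK (parts_gt0 be)) E comp_codeK // filter_all.
have del0_pos r : all (fun x => 0 < x.2) r -> del0 r = r by move/all_filterP.
case: k => [|k] le_k Eb.
  have {}Eb : parts be = del0 ((e, 1) :: al) by apply: be_code.
  have al_gt0 := parts_gt0 al; rewrite del0_pos ?/= // in Eb.
  case Ea: (parts al) al_gt0 Eb => [|[f a] q] /= al_gt0 Eb.
    exact: cover_empty Ea Eb.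
  have [a_gt0 q_gt0] := andP al_gt0.
  (* A new first part of size 1 comes from [h = 0], by splitting or inserting according to the color
     of the old first part. *)
  have [eq_ef|neq_ef] := eqVneq e f.
    by apply: (@cover_split _ _ _ [::] f a q 0); rewrite ?subn0 // Eb eq_ef.
  apply: (@cover_insert _ _ _ [::] f a q 0 e) => //.
  by rewrite subn0 /= a_gt0 Eb; congr [:: _, _ & _]; rewrite -/(del0 q) del0_pos.
have [p [f [a [q [h [Ea h_a Ek]]]]]] := comp_code_position le_k.
have := parts_gt0 al; rewrite Ea all_cat /= => /and3P[p_gt0 a_gt0 q_gt0].
have [h_gt0 le_ha] := andP h_a.
move: Eb; rewrite Ek Ea code_insert_part // => /be_code.
have [_{e}|neq_fe] := eqVneq f e => Eb; last first.
  by apply: cover_insert Ea _ le_ha Eb; rewrite eq_sym.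
rewrite /del0 !filter_cat /= -!/(del0 _) !del0_pos // subn_gt0 in Eb.
(* With equal colors, [h = a] lengthens the part and [h < a] splits it. *)
move: le_ha Eb; rewrite leq_eqVlt => /orP[/eqP ->|lt_ha]; rewrite ?ltnn ?lt_ha.
  exact: cover_incr Ea.
exact: cover_split Ea lt_ha.
Qed.

(** * Colored permutations and their largest letter *)

Lemma colored_perms_size n u : colored_perms n u -> size u = n.
Proof. by move/perm_size; rewrite size_map size_iota. Qed.

Lemma colored_perms_le n u : colored_perms n u -> all (fun x => x.2 < n.+1) u.
Proof.
move=> u_perm; apply/allP => x x_u.
have: x.2 \in iota 1 n by rewrite -(perm_mem u_perm) map_f.
by rewrite mem_iota => /andP[].
Qed.

Lemma colored_perms_cat_cons n u v e :
  colored_perms n.+1 (u ++ (e, n.+1) :: v) <-> colored_perms n (u ++ v).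
Proof.
rewrite /colored_perms -[in iota 1 n.+1](addn1 n) iotaD add1n !map_cat /=.
by rewrite (perm_catCA _ [:: n.+1]) perm_sym perm_catC /= perm_cons perm_sym.
Qed.

Lemma colored_perms_insert n u e k :
  colored_perms n u -> colored_perms n.+1 (word_insert (e, n.+1) k u).
Proof.
by move=> u_perm; apply/colored_perms_cat_cons; rewrite cat_take_drop.
Qed.

Lemma colored_permsS n u : colored_perms n.+1 u -> exists e k v,
  [/\ colored_perms n v, k <= n & u = word_insert (e, n.+1) k v].
Proof.
move=> u_perm.
have: n.+1 \in [seq x.2 | x <- u].
  by rewrite (perm_mem u_perm) mem_iota add1n ltnS leqnn.
case/mapP=> -[e b] /= u_e def_b; rewrite -def_b in u_e.
case/splitPr: u_e u_perm => u1 u2 u_perm.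
have v_perm := (colored_perms_cat_cons _ _ _ _).1 u_perm.
exists e, (size u1), (u1 ++ u2); split=> //.
  by rewrite -(colored_perms_size v_perm) size_cat leq_addr.
by rewrite /word_insert take_size_cat // drop_size_cat.
Qed.

Lemma subword_insert n i u e k : i <= n ->
  subword (word_insert (e, n.+1) k u) i = subword u i.
Proof.
move=> le_in; rewrite /subword /word_insert filter_cat /= mem_iota /= add1n ltnS.
by rewrite ltnNge le_in /= -filter_cat cat_take_drop.
Qed.

Lemma subword_perm n u : colored_perms n u -> subword u n = u.
Proof.
move=> u_perm; apply/all_filterP/allP => x x_u.
by rewrite -(perm_mem u_perm) map_f.
Qed.

(** The subwords of index at most [n] do not see the letter [n.+1], so the chain is only prolonged;
    this drives the inductions on [n]. *)
Lemma mmap_insert n u e k : colored_perms n u ->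
  mmap n.+1 (word_insert (e, n.+1) k u)
  = rcons (mmap n u) (cdes (word_insert (e, n.+1) k u)).
Proof.
move=> u_perm; rewrite /mmap -[in iota 1 n.+1](addn1 n) iotaD map_cat /= add1n cats1.
rewrite (subword_perm (colored_perms_insert _ _ u_perm)); congr rcons.
apply/eq_in_map => i; rewrite mem_iota add1n ltnS => /andP[_ le_in].
by rewrite subword_insert.
Qed.

(** * The bijection with saturated chains *)

Lemma last_mmap n u : colored_perms n u -> last cempty (mmap n u) = cdes u.
Proof.
case: n => [|n] u_perm.
  (* The default [cempty] of [last] is the descent composition of the empty word. *)
  by have /size0nil -> := colored_perms_size u_perm; apply: val_inj.
have [e [k [v [v_perm _ def_u]]]] := colored_permsS u_perm.
by rewrite def_u mmap_insert // last_rcons.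
Qed.

Lemma size_mmap n u : size (mmap n u) = n.
Proof. by rewrite size_map size_iota. Qed.

Lemma cdes_insert_cover n u e k : colored_perms n u -> k <= n ->
  Defs.cover (cdes u) (cdes (word_insert (e, n.+1) k u)).
Proof.
move=> u_perm le_kn; have size_u := colored_perms_size u_perm.
apply: (@code_insert_cover _ _ e k); rewrite /= comp_code_cruns.
  by rewrite size_word_code size_u.
by rewrite comp_code_cruns word_code_insert ?size_u ?colored_perms_le.
Qed.

Lemma cover_cdes_insert n u be : colored_perms n u -> Defs.cover (cdes u) be ->
  exists e k, be = cdes (word_insert (e, n.+1) k u).
Proof.
move=> u_perm /cover_code_insert[e [k []]].
rewrite /= comp_code_cruns size_word_code => le_k E.
exists e, k; apply: comp_code_inj.
by rewrite E /= comp_code_cruns word_code_insert ?colored_perms_le.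
Qed.

Lemma mmap_cover n u i : colored_perms n u -> i < n ->
  Defs.cover (nth cempty (cempty :: mmap n u) i) (nth cempty (cempty :: mmap n u) i.+1).
Proof.
elim: n u => // n IH u /colored_permsS[e [k [v [v_perm le_k ->]]]].
rewrite mmap_insert // -rcons_cons ltnS leq_eqVlt => /orP[/eqP ->|lt_in].
  rewrite !nth_rcons /= size_mmap ltnS leqnn ltnn eqxx.
  have -> : nth cempty (cempty :: mmap n v) n = cdes v.
    by rewrite -(last_mmap v_perm) -{2}(size_mmap n v) nth_last.
  exact: cdes_insert_cover.
by rewrite !nth_rcons /= size_mmap ltnS (ltnW lt_in) ltnS lt_in; apply: IH.
Qed.

Lemma mmap_inj n u v : colored_perms n u -> colored_perms n v ->
  mmap n u = mmap n v -> u = v.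
Proof.
elim: n u v => [|n IH] u v.
  by move=> /colored_perms_size/size0nil -> /colored_perms_size/size0nil ->.
case/colored_permsS=> e [k [u' [u'_perm le_k ->]]].
case/colored_permsS=> f [l [v' [v'_perm le_l ->]]].
(* The first [n] terms identify the smaller permutations; the last terms then compare two insertions
   into the same word. *)
rewrite !mmap_insert // => /rcons_inj[/(IH _ _ u'_perm v'_perm) <-{v' v'_perm}].
move/(congr1 (@comp_code)).
have size_u' := colored_perms_size u'_perm.
rewrite !comp_code_cruns !word_code_insert ?size_u' ?colored_perms_le //.
by case/code_insert_inj; rewrite ?size_word_code ?size_u' // => -> ->.
Qed.

Lemma mmap_surj n (s : seq (ccomp C)) : size s = n ->
  (forall i, i < n -> Defs.cover (nth cempty (cempty :: s) i) (nth cempty (cempty :: s) i.+1)) ->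
  exists2 u, colored_perms n u & mmap n u = s.
Proof.
elim: n s => [|n IH] s; first by move=> /size0nil -> _; exists [::].
case/lastP: s => // s be; rewrite size_rcons => -[size_s] chain_s.
have [||u u_perm def_s] := IH s => // [i lt_in|].
  by have := chain_s i (leqW lt_in); rewrite -rcons_cons !nth_rcons /= size_s ltnS (ltnW lt_in) ltnS lt_in.
have := chain_s n (leqnn _); rewrite -rcons_cons !nth_rcons /= size_s ltnS leqnn ltnn eqxx.
have -> : nth cempty (cempty :: s) n = cdes u.
  by rewrite -(last_mmap u_perm) def_s -{1}size_s nth_last.
(* The final cover of the chain dictates where, and with which color, the letter [n.+1] enters. *)
case/(cover_cdes_insert u_perm)=> e [k ->].
exists (word_insert (e, n.+1) k u); first exact: colored_perms_insert.
by rewrite mmap_insert // def_s.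
Qed.

Lemma mmap_bij n :
  set_bij (@colored_perms C n) (@saturated_chains C n) (fun u => cempty :: mmap n u).
Proof.
split.
- move=> u u_perm; exists (cdes u).
    by rewrite csize_cdes (colored_perms_size u_perm).
  split=> //=; first by rewrite size_mmap.
    by move=> i; apply: mmap_cover.
  by rewrite -(last_mmap u_perm) -{2}(size_mmap n u) nth_last.
- move=> u v; rewrite !inE => u_perm v_perm [].
  exact: mmap_inj.
move=> [|al0 s] [al _ [//= [size_s] -> chain_s _]].
by have [u u_perm <-] := mmap_surj size_s chain_s; exists u.
Qed.

End RunCodes.

Theorem theorem2p1 (m n : nat) (w : algC) (hm : 0 < m) (hn : 0 < n)
    (hw : (m.-primitive_root w)%R) :
  set_bij (@colored_perms (Cm m w) n) (@saturated_chains (Cm m w) n)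
    (fun u : word (Cm m w) => cempty :: mmap n u).
Proof. exact: mmap_bij. Qed.
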